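(* Let $F$ be a field, let $A$ be an $m\times n$ matrix over $F$ with columns labeled, in order, by $x_1,\dots,x_n$, and let $M=M_F[A]$. Then the set $\mathcal{C}(M)$ of circuits of $M$ satisfies $$\mathcal{C}(M)=\mathrm{Min}\big(\{\theta(\mathbf{v}):\mathbf{v}\in\mathcal{N}_F(A)\}\setminus\{\emptyset\}\big).$$
   Context: Let $U=\{x_1,\dots,x_n\}$ be the set of column labels. The vector matroid $M_F[A]$ is the matroid on $U$ in which $X\subseteq U$ is independent iff the family of columns of $A$ labeled by $X$ is linearly independent in $F^m$. Its circuits are the inclusion-minimal dependent subsets of $U$. The null space is $\mathcal{N}_F(A)=\{\mathbf{x}\in F^n: A\mathbf{x}=\mathbf{0}\}$. The support of $\mathbf{v}=(v_1,\dots,v_n)^T\in F^n$ is $\theta(\mathbf{v})=\{x_i\in U: v_i\neq 0\}$. For a family $\mathcal{S}$ of subsets of $U$, $\mathrm{Min}(\mathcal{S})$ is the family of inclusion-minimal members of $\mathcal{S}$, i.e. $\{X\in\mathcal{S}:\forall Y\in\mathcal{S},\ Y\subseteq X\Rightarrow X=Y\}$. *)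

(* Defs.v *)
From mathcomp Require Import all_boot all_order all_algebra.
From mathcomp Require Import boolp classical_sets.

Set Implicit Arguments.
Unset Strict Implicit.
Unset Printing Implicit Defensive.

Import GRing.Theory.
Local Open Scope ring_scope.
Local Open Scope classical_set_scope.

(* Subsets of the finite ground set [U] are elements of [{set U}]; families of
   subsets are classical sets [set {set U}], because membership in a family
   such as the supports of the vectors of a null space is a [Prop] over a
   possibly infinite field. *)

Definition Min (U : finType) (S : set {set U}) : set {set U} :=
  [set X | S X /\ forall Y : {set U}, S Y -> Y \subset X -> X = Y].

Record matroid (U : finType) : Type := Matroid {
  indep : pred {set U};
  indep0 : indep finset.set0;
  indepS : forall X Y : {set U}, X \subset Y -> indep Y -> indep X;
  indep_aug : forall X Y : {set U}, indep X -> indep Y -> (#|X| < #|Y|)%N ->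
    exists2 e : U, e \in Y :\: X & indep (e |: X)
}.

Definition circuits (U : finType) (M : matroid U) : set {set U} :=
  Min [set X | ~~ indep M X].

Section VectorMatroid.
Variables (F : fieldType) (m n : nat) (A : 'M[F]_(m, n)).
(* [x i] is the label of column [i] of [A]. *)
Variables (U : finType) (x : 'I_n -> U).

Definition columns (X : {set U}) : seq 'cV[F]_m :=
  [seq col i A | i <- enum 'I_n & x i \in X].

(* [free] is linear independence of a family: it fails if a vector is
   repeated, so equal columns with distinct labels are dependent. *)
Definition vector_indep (X : {set U}) : bool := free (columns X).

Hypothesis x_bij : bijective x.

Let x_inj : injective x := bij_inj x_bij.

Lemma size_columns (X : {set U}) : size (columns X) = #|X|.
Proof.
have [y xK yK] := x_bij.
rewrite size_map -(card_imset _ (can_inj yK)) cardE.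
apply: perm_size; apply: uniq_perm => [||i]; rewrite ?enum_uniq //.
  by apply: filter_uniq; rewrite enum_uniq.
rewrite mem_filter !mem_enum andbT; apply/idP/imsetP => [xiX|[u uX ->]].
  by exists (x i); rewrite ?xK.
by rewrite yK.
Qed.

Lemma columns_setU1 (i : 'I_n) (X : {set U}) :
  x i \notin X -> perm_eq (columns (x i |: X)) (col i A :: columns X).
Proof.
move=> xiX; rewrite -[col i A :: _]/(map (fun j => col j A) (i :: _)); apply: perm_map.
have uniqI (P : pred 'I_n) : uniq [seq j <- enum 'I_n | P j].
  by apply: filter_uniq; rewrite enum_uniq.
apply: uniq_perm => [||j]; rewrite ?cons_uniq ?uniqI //.
  by rewrite mem_filter (negPf xiX).
rewrite inE mem_filter mem_enum mem_filter mem_enum !andbT !inE.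
by rewrite (inj_eq x_inj).
Qed.

Lemma vector_indep0 : vector_indep finset.set0.
Proof.
rewrite /vector_indep (_ : columns _ = [::]) ?nil_free //.
by apply/eqP; rewrite -size_eq0 size_columns cards0.
Qed.

Lemma vector_indepS (X Y : {set U}) :
  X \subset Y -> vector_indep Y -> vector_indep X.
Proof.
move=> /fintype.subsetP sXY; rewrite /vector_indep.
have -> : columns X = [seq col i A | i <- [seq i <- [seq i <- enum 'I_n
    | x i \in Y] | x i \in X]].
  rewrite /columns -filter_predI; congr map; apply: eq_filter => i /=.
  by case: (boolP (x i \in X)) => // /sXY ->.
have : perm_eq (columns Y)
   ([seq col i A | i <- [seq i <- [seq i <- enum 'I_n | x i \in Y] | x i \in X]]
   ++ [seq col i A | i <- [seq i <- [seq i <- enum 'I_n | x i \in Y]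
       | x i \notin X]]).
  by rewrite -map_cat perm_map // perm_sym perm_filterC.
by move/perm_free=> ->; apply: catl_free.
Qed.

Lemma vector_indep_aug (X Y : {set U}) :
  vector_indep X -> vector_indep Y -> (#|X| < #|Y|)%N ->
  exists2 e : U, e \in Y :\: X & vector_indep (e |: X).
Proof.
move=> indX indY ltXY.
case: (boolP [exists e in Y :\: X, vector_indep (e |: X)]) => [/exists_inP //|].
rewrite negb_exists_in => /forall_inP noe.
suff /dimvS : (<<columns Y>> <= <<columns X>>)%VS.
  by rewrite (eqP indX) (eqP indY) !size_columns leqNgt ltXY.
apply/span_subvP => v /mapP[i]; rewrite mem_filter => /andP[xiY _] ->.
have [xiX|xiX] := boolP (x i \in X).
  by apply/memv_span/map_f; rewrite mem_filter xiX mem_enum.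
have := noe (x i); rewrite inE xiX xiY => /(_ isT).
rewrite /vector_indep (perm_free (columns_setU1 xiX)) free_cons.
by move: indX; rewrite /vector_indep => ->; rewrite andbT negbK.
Qed.

Definition vector_matroid : matroid U :=
  Matroid vector_indep0 vector_indepS vector_indep_aug.

Definition null_space : set 'cV[F]_n := [set v | A *m v = 0].

Definition vsupport (v : 'cV[F]_n) : {set U} :=
  (x @: [set i | v i ord0 != 0]%SET)%SET.

End VectorMatroid.

(* Main.v *)
Require Import Defs.
From mathcomp Require Import all_boot all_order all_algebra.
From mathcomp Require Import boolp classical_sets.

Import GRing.Theory.
Local Open Scope ring_scope.
Local Open Scope classical_set_scope.

(** A set of labels is dependent iff it contains the support of a nonzero null
    vector, and such a support is itself dependent. Hence the nonempty supports
    form a subfamily of the dependent sets, every member of which contains a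
    member of the subfamily, so both families have the same minimal members. *)

Lemma eq_Min (U : finType) (S D : set {set U}) :
  S `<=` D -> (forall X, D X -> exists2 Y, S Y & Y \subset X) -> Min D = Min S.
Proof.
move=> sSD cover; apply/seteqP; split=> X [XM minX]; split.
(* A minimal member of [D] contains a member of [S], which also lies in [D] and so equals it. *)
- by have [Y SY sYX] := cover X XM; rewrite (minX Y (sSD Y SY) sYX).
- by move=> Y /sSD; apply: minX.
- exact: sSD.
- move=> Y /cover[Z SZ sZY] sYX.
  (* Minimality in [S] squeezes the chain [Z], [Y], [X] to equalities. *)
  have eXZ := minX Z SZ (fintype.subset_trans sZY sYX).
  by apply/eqP; rewrite finset.eqEsubset sYX eXZ sZY.
Qed.

(** Reindexes [freeP], whose coefficients are attached to positions, by the elements of [s]. As [s]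
    has no repetition, each element has one position, even where [f] takes equal values. *)
Lemma free_mapP (K : fieldType) (vT : vectType K) (I : eqType) (f : I -> vT)
    (s : seq I) : uniq s ->
  reflect (forall c : I -> K, \sum_(i <- s) c i *: f i = 0 ->
             {in s, forall i, c i = 0})
          (free [seq f i | i <- s]).
Proof.
move=> uniq_s; pose t := map_tuple f (in_tuple s).
apply: (iffP (@freeP _ _ _ t)) => [free_t c c0 i si | free_s k k0 j].
  have lt_i : (index i s < size s)%N by rewrite index_mem.
  rewrite -(nth_index i si).
  apply: (free_t (fun j => c (nth i s j)) _ (Ordinal lt_i)).
  rewrite -{}[RHS]c0 (big_nth i) big_mkord; apply: eq_bigr => j _.
  by rewrite (nth_map i).
(* The position [j] shows that [s] is nonempty, which supplies a default for [nth]. *)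
have i0 : I by case: s {uniq_s t free_s k k0} j => [[]|].
(* Elements outside [s] have index [size s], so [insub] fails and they get the value 0. *)
pose c i := if insub (index i s) is Some j then k j else 0.
have cE l : c (nth i0 s (nat_of_ord l)) = k l.
  by rewrite /c index_uniq // valK.
rewrite -cE; apply: free_s; last exact: mem_nth.
rewrite -[RHS]k0 (big_nth i0) big_mkord; apply: eq_bigr => l _.
by rewrite cE (nth_map i0).
Qed.

Lemma mulmx_col (F : fieldType) (m n : nat) (A : 'M[F]_(m, n))
    (v : 'cV[F]_n) : A *m v = \sum_i v i ord0 *: col i A.
Proof.
apply/matrixP => k l; rewrite ord1 mxE summxE; apply: eq_bigr => i _.
by rewrite !mxE mulrC.
Qed.

Lemma vsupport_eq0 (F : fieldType) (n : nat) (U : finType) (x : 'I_n -> U)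
    (v : 'cV[F]_n) : vsupport x v = finset.set0 <-> v = 0.
Proof.
split=> [/eqP | ->].
  rewrite imset_eq0 => /eqP v0; apply/matrixP => i j; rewrite ord1 mxE.
  by apply/eqP; move/setP/(_ i): v0; rewrite !inE => /negbFE.
by apply/eqP; rewrite imset_eq0; apply/eqP/setP => i; rewrite !inE mxE eqxx.
Qed.

Lemma vsupport_sub (F : fieldType) (n : nat) (U : finType) (x : 'I_n -> U)
    (v : 'cV[F]_n) (X : {set U}) :
  vsupport x v \subset X <-> forall i, x i \notin X -> v i ord0 = 0.
Proof.
split=> [/fintype.subsetP sX i xiX | v0].
  by apply: contraNeq xiX => vi; apply/sX/imset_f; rewrite inE.
apply/fintype.subsetP => _ /imsetP[i + ->]; rewrite inE.
by apply: contraR => /v0 ->.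
Qed.

(** A linear relation among the columns labeled by [X], extended by zero to the other columns, is a
    null vector supported in [X], and conversely. *)
Lemma dependentP (F : fieldType) (m n : nat) (A : 'M[F]_(m, n)) (U : finType)
    (x : 'I_n -> U) (X : {set U}) :
  ~~ vector_indep A x X <->
  exists v : 'cV[F]_n, [/\ A *m v = 0, v <> 0 & vsupport x v \subset X].
Proof.
have uniqX : uniq [seq i <- enum 'I_n | x i \in X].
  by rewrite filter_uniq ?enum_uniq.
have sumX (c : 'I_n -> F) : (forall i, x i \notin X -> c i = 0) ->
    \sum_(i <- [seq i <- enum 'I_n | x i \in X]) c i *: col i A
    = \sum_i c i *: col i A.
  move=> c0; rewrite big_filter big_enum_cond [RHS](bigID (fun i => x i \in X)) /=.
  by rewrite [X in _ + X]big1 ?addr0 // => i /c0 ->; rewrite scale0r.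
split=> [dep | [v [Av0 v_neq0 /vsupport_sub vX]]]; last first.
  apply/negP => /(free_mapP _ _ _ _ _ uniqX)/(_ (fun i => v i ord0)).
  rewrite (sumX _ vX) -mulmx_col => /(_ Av0) v0; apply: v_neq0.
  apply/matrixP => i j; rewrite ord1 mxE.
  have [xiX|/vX //] := boolP (x i \in X).
  by apply: v0; rewrite mem_filter xiX mem_enum.
apply: contrapT => no_v; move/negP: dep; apply.
apply/(free_mapP _ _ _ _ _ uniqX) => c c0 i; rewrite mem_filter => /andP[xiX _].
(* The relation [c] is arbitrary off [X], so it is cut to zero there to force the support into
   [X]. *)
pose v : 'cV[F]_n := \col_i (if x i \in X then c i else 0).
have vX j : x j \notin X -> v j ord0 = 0 by rewrite mxE => /negPf ->.
suff /matrixP/(_ i ord0) : v = 0 by rewrite !mxE xiX.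
apply: contrapT => v_neq0; apply: no_v; exists v; split=> //.
  rewrite mulmx_col -(sumX _ vX) -[RHS]c0 !big_filter.
  by apply: eq_bigr => j xjX; rewrite mxE xjX.
exact/vsupport_sub.
Qed.

Theorem theorem2 (F : fieldType) (m n : nat) (A : 'M[F]_(m, n))
    (U : finType) (x : 'I_n -> U) (x_bij : bijective x) :
  circuits (vector_matroid A x_bij) =
  Min ([set vsupport x v | v in null_space A] `\` [set finset.set0]).
Proof.
apply: eq_Min => [_ [[v Av0 <-] suppv] | X /dependentP[v [Av0 v_neq0 sX]]].
  (* A nonempty support comes from a nonzero [v], which itself witnesses that its support is
     dependent. *)
  by apply/dependentP; exists v; split=> // /(vsupport_eq0 _ _ _ x)/suppv.
by exists (vsupport x v) => //; split; [exists v | move/vsupport_eq0].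
Qed.
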